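(* Let $F$ be a mixed graph such that $\theta(F)<\infty$. Then $\theta(F)$ is an algebraic number.
   Context: A mixed graph $G$ has a finite vertex set and an edge set; each edge is on a pair of distinct vertices, there is at most one edge on any pair, and each edge is either undirected ($uv$) or directed from a tail $u$ to a head $v$. Let $e_u(G),e_d(G)$ be the numbers of undirected and directed edges, and $\alpha(G)=e_u(G)/\binom{v(G)}{2}$, $\beta(G)=e_d(G)/\binom{v(G)}{2}$. $F\subseteq G$ means there is an injection $\phi:V(F)\to V(G)$ sending each undirected edge of $F$ to a pair joined by an edge of either type in $G$ and each directed edge $u\to v$ of $F$ to the directed edge $\phi(u)\to\phi(v)$ of $G$ (i.e. $F$ is obtained from $G$ by deleting vertices, deleting edges and forgetting directions). $G$ is $F$-free if $F\not\subseteq G$. The Turán density coefficient $\theta(F)$ is the maximum $\rho$ such that $\limsup_{n\to\infty}\max\{\alpha(G)+\rho\beta(G): G\ F\text{-free on } n \text{ vertices}\}\le 1$; if $\max\beta(G)\to 0$ over $F$-free $n$-vertex $G$, then $\theta(F)=\infty$. *)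

(* Defs.v *)
From HB Require Import structures.
From mathcomp Require Import all_boot all_order all_algebra.
From mathcomp Require Import all_classical all_reals all_analysis.
From mathcomp Require Import lra.

Set Implicit Arguments.
Unset Strict Implicit.
Unset Printing Implicit Defensive.

Import Order.TTheory GRing.Theory Num.Theory.
Import numFieldNormedType.Exports.

Local Open Scope classical_set_scope.
Local Open Scope ring_scope.

(* E.1 is the set of undirected edges, as 2-element sets of vertices; E.2 is
   the set of directed edges, as pairs (tail, head). *)
Definition mixed_graph_axiom (V : finType) (E : {set {set V}} * {set V * V}) :=
  [forall e in E.1, #|e| == 2%N] &&
  [forall x, forall y, ((x, y) \in E.2) ==>
     [&& x != y, (y, x) \notin E.2 & [set x; y]%SET \notin E.1]].

Record mixed_graph (V : finType) := MixedGraph {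
  mixed_graph_val : {set {set V}} * {set V * V};
  _ : mixed_graph_axiom mixed_graph_val
}.

HB.instance Definition _ (V : finType) := [isSub for @mixed_graph_val V].
HB.instance Definition _ (V : finType) := [Finite of mixed_graph V by <:].

Definition uedges (V : finType) (G : mixed_graph V) : {set {set V}} :=
  (mixed_graph_val G).1.

Definition dedges (V : finType) (G : mixed_graph V) : {set V * V} :=
  (mixed_graph_val G).2.

Definition joined (V : finType) (G : mixed_graph V) (x y : V) : bool :=
  [|| [set x; y]%SET \in uedges G, (x, y) \in dedges G | (y, x) \in dedges G].

Definition mixed_subgraph (V W : finType)
    (F : mixed_graph V) (G : mixed_graph W) : bool :=
  [exists phi : {ffun V -> W},
    [&& injectiveb phi,
        [forall x, forall y,
           ([set x; y]%SET \in uedges F) ==> joined G (phi x) (phi y)]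
      & [forall x, forall y,
           ((x, y) \in dedges F) ==> ((phi x, phi y) \in dedges G)]]].

Definition mixed_free (V W : finType)
    (F : mixed_graph V) (G : mixed_graph W) : bool :=
  ~~ mixed_subgraph F G.

Section TuranDensity.
Variable R : realType.

Definition alpha (V : finType) (G : mixed_graph V) : R :=
  #|uedges G|%:R / 'C(#|V|, 2)%:R.

Definition beta (V : finType) (G : mixed_graph V) : R :=
  #|dedges G|%:R / 'C(#|V|, 2)%:R.

Variables (V : finType) (F : mixed_graph V).

(* The maxima range over the finitely many F-free mixed graphs with vertex set
   'I_n, and are -oo when there is none (which happens for all large n exactly
   when F has no edge; theta is then +oo). *)
Definition max_density (rho : R) (n : nat) : \bar R :=
  \big[maxe/-oo%E]_(G : mixed_graph 'I_n | mixed_free F G)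
     (alpha G + rho * beta G)%:E.

Definition max_beta (n : nat) : \bar R :=
  \big[maxe/-oo%E]_(G : mixed_graph 'I_n | mixed_free F G) (beta G)%:E.

Definition admissible (rho : R) : Prop :=
  (limn_esup (max_density rho) <= 1)%E.

(* The supremum is a maximum whenever it is finite: see theta_max. *)
Definition theta : \bar R :=
  if `[< max_beta n @[n --> \oo] --> (0 : \bar R) >] then +oo%E
  else ereal_sup [set rho%:E | rho in admissible].

End TuranDensity.

Lemma alpha_le1 (R : realType) (V : finType) (G : mixed_graph V) :
  alpha R G <= 1.
Proof.
rewrite /alpha; have [->|C0] := posnP 'C(#|V|, 2); first by rewrite invr0 mulr0.
rewrite ler_pdivrMr ?ltr0n// mul1r ler_nat -(card_draws V 2).
apply/subset_leq_card/fintype.subsetP => e eG; rewrite inE.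
case: G eG => -[U D] Gax; rewrite /uedges /=.
by case/andP: Gax => /forall_inP UP _ /UP.
Qed.

Lemma beta_ge0 (R : realType) (V : finType) (G : mixed_graph V) :
  0 <= beta R G.
Proof. by rewrite divr_ge0. Qed.

Lemma beta_le1 (R : realType) (V : finType) (G : mixed_graph V) :
  beta R G <= 1.
Proof.
rewrite /beta; have [->|C0] := posnP 'C(#|V|, 2); first by rewrite invr0 mulr0.
rewrite ler_pdivrMr ?ltr0n// mul1r ler_nat -(card_draws V 2).
have DP x y : (x, y) \in dedges G -> (x != y) && ((y, x) \notin dedges G).
  case: G => -[U D] Gax; rewrite /dedges /= => xyD.
  case/andP: Gax => _ /forallP/(_ x)/forallP/(_ y)/implyP/(_ xyD).
  by case/and3P=> -> ->.
rewrite -(card_in_imset (f := fun p : V * V => [set p.1; p.2]%SET)).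
  apply/subset_leq_card/fintype.subsetP => e /imsetP[[x y] /DP/andP[xy _] ->].
  by rewrite inE cards2 xy.
move=> [x y] [z t] /[dup] xyG /DP/andP[xy _] /DP/andP[_ tz] /= /setP eqs.
have /esym := eqs x; have /esym := eqs y.
rewrite !inE !eqxx orbT/= => /orP[]/eqP yE /orP[]/eqP xE; subst x y => //.
- by rewrite eqxx in xy.
- by rewrite xyG in tz.
- by rewrite eqxx in xy.
Qed.

Lemma admissibleP (R : realType) (V : finType) (F : mixed_graph V) (rho : R) :
  admissible F rho <->
  forall e : R, 0 < e -> exists N : nat, forall n, (N <= n)%N ->
    forall G : mixed_graph 'I_n, mixed_free F G ->
    alpha R G + rho * beta R G <= 1 + e.
Proof.
split=> [adm e e0|h].
  have /ereal_inf_lt[_ /= [A [N _ NA] <-] ltA] :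
      (limn_esup (max_density F rho) < (1 + e)%:E)%E.
    by apply: le_lt_trans adm _; rewrite lte_fin ltrDl.
  exists N => n Nn G FG; rewrite -lee_fin.
  apply: (@le_trans _ _ (max_density F rho n)).
    exact: (le_bigmax_cond _ (fun G => (alpha R G + rho * beta R G)%:E)).
  apply: le_trans (ltW ltA); apply: ereal_sup_ubound => /=.
  by exists n => //; exact: NA.
apply/lee_addgt0Pr => e e0; have [N hN] := h e e0.
apply: (@le_trans _ _
    (ereal_sup (max_density F rho @` [set n | (N <= n)%N]))).
  by apply: ereal_inf_lbound; exists [set n | (N <= n)%N] => //; exists N.
apply: ge_ereal_sup => _ [n /= Nn <-]; rewrite -EFinD.
by apply: bigmax_le => [|G FG]; rewrite ?leNye// lee_fin; exact: hN.
Qed.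

Lemma theta_max (R : realType) (V : finType) (F : mixed_graph V) :
  (theta R F < +oo)%E ->
  exists t : R, [/\ theta R F = t%:E, admissible F t &
    forall rho, admissible F rho -> rho <= t].
Proof.
rewrite /theta; case: ifP => // _; set S := [set _ | _ in _] => Soo.
have S0 : S 0%E.
  exists 0 => //; apply/admissibleP => e e0; exists 0%N => n _ G _.
  by rewrite mul0r addr0 (le_trans (alpha_le1 _ _))// lerDl ltW.
have tE : ereal_sup S = (fine (ereal_sup S))%:E.
  by rewrite fineK// ge0_fin_numE//; exact: ereal_sup_ubound.
exists (fine (ereal_sup S)); split=> //; last first.
  by move=> rho arho; rewrite -lee_fin -tE; apply: ereal_sup_ubound; exists rho.
set t := fine _ in tE *; apply/admissibleP => e e0.
have e20 : 0 < e / 2 by rewrite divr_gt0.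
have /ereal_sup_gt[_ [rho arho <-]] : ((t - e / 2)%:E < ereal_sup S)%E.
  by rewrite tE lte_fin ltrBlDr ltrDl.
rewrite lte_fin ltrBlDr => trho.
have /admissibleP/(_ _ e20)[N hN] := arho.
exists N => n Nn G FG; have := hN n Nn G FG.
have b0 := beta_ge0 R G; have b1 := beta_le1 R G.
have : t * beta R G <= (rho + e / 2) * beta R G by rewrite ler_wpM2r// ltW.
have : e / 2 * beta R G <= e / 2 by rewrite ler_piMr// ltW.
by rewrite mulrDl => h1 h2 h3; lra.
Qed.

(* Main.v *)
(** By supersaturation and blow-ups, [rho >= 1] is admissible iff the weighted
    edge density of every pattern to which F has no homomorphism is at most 1;
    Zykov symmetrization reduces this to patterns in which all pairs of distinct
    vertices are joined. For such a pattern, whose directed edges form the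
    oriented graph D with symmetrized adjacency matrix B, the condition says that
    [1 - (rho - 1) B] is positive semidefinite, so theta(F) = 1 + 1/sup |B|, the
    supremum of the spectral radii over all D avoiding F in this sense.

    If D can be an arbitrarily large star with all edges directed away from the
    centre, or all towards it, then theta(F) = 1. Otherwise F maps to both kinds
    of stars: its tails are pairwise non-adjacent and so are its heads, so F maps
    to a single directed edge plus enough other vertices. Hence every D avoiding
    F and having an edge has fewer than |V(F)| + 2 vertices, the supremum is
    attained, and theta(F) is a root of [det (1 - (X - 1) B)] for some D. *)

Require Import Defs.
From mathcomp Require Import all_boot all_order all_algebra.
From mathcomp Require Import all_classical all_reals all_analysis.
From mathcomp Require Import ring lra.

Set Implicit Arguments.
Unset Strict Implicit.
Unset Printing Implicit Defensive.

Import Order.TTheory GRing.Theory Num.Theory.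
Local Open Scope ring_scope.

(** * Patterns, homomorphisms and edge weights *)

(* A possibly infinite mixed graph: [j] says that two vertices are joined by an
   edge of either type, [d] that they are joined by a directed edge. *)
Definition pattern (U : Type) (j d : rel U) : Prop :=
  [/\ symmetric j, irreflexive j, subrel d j & forall x y, d x y -> ~~ d y x].

Definition is_hom (V : finType) (F : mixed_graph V) (U : Type) (j d : rel U)
    (phi : V -> U) : bool :=
  [forall x, forall y,
     (([set x; y]%SET \in uedges F) ==> j (phi x) (phi y)) &&
     (((x, y) \in dedges F) ==> d (phi x) (phi y))].

Definition hom_free (V : finType) (F : mixed_graph V) (U : Type)
    (j d : rel U) : Prop :=
  forall phi, ~~ is_hom F j d phi.

(** Directions are forgotten: the weight is symmetric, so a double sum over ordered pairs counts
    each edge twice. *)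
Definition weight (R : realType) (rho : R) (U : Type) (j d : rel U) (x y : U) : R :=
  if d x y || d y x then rho else (j x y)%:R.

Lemma is_homP (V : finType) (F : mixed_graph V) (U : Type) (j d : rel U)
    (phi : V -> U) :
  reflect ((forall x y, [set x; y]%SET \in uedges F -> j (phi x) (phi y)) /\
           (forall x y, (x, y) \in dedges F -> d (phi x) (phi y)))
          (is_hom F j d phi).
Proof.
apply: (iffP forallP) => [h|[hu hd] x].
  by split=> x y; have /forallP/(_ y)/andP[/implyP hu /implyP hd] := h x.
by apply/forallP => y; apply/andP; split; apply/implyP; [exact: hu|exact: hd].
Qed.

Lemma hom_free_comp (V : finType) (F : mixed_graph V) (U U' : Type)
    (j d : rel U) (j' d' : rel U') (h : U' -> U) :
  (forall x y, j' x y -> j (h x) (h y)) ->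
  (forall x y, d' x y -> d (h x) (h y)) ->
  hom_free F j d -> hom_free F j' d'.
Proof.
move=> jh dh free phi; apply: contra (free (h \o phi)) => /is_homP[hu hd].
by apply/is_homP; split=> x y /=; [move/hu/jh|move/hd/dh].
Qed.

(** As [h] need not be injective, this covers blow-ups, samples and restrictions alike; vertices
    with the same image are not joined. *)
Lemma pattern_pull (U U' : Type) (j d : rel U) (h : U' -> U) :
  pattern j d -> pattern (fun x y => j (h x) (h y)) (fun x y => d (h x) (h y)).
Proof.
case=> js ji dj da; split=> [x y|x|x y|x y].
- exact: js.
- exact: ji.
- exact: dj.
- exact: da.
Qed.

(** * Mixed graphs as patterns, densities as sums of weights *)

Lemma mixed_graphP (V : finType) (G : mixed_graph V) :
  (forall e, e \in uedges G -> #|e| = 2%N) /\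
  (forall x y, (x, y) \in dedges G ->
     [/\ x != y, (y, x) \notin dedges G & [set x; y]%SET \notin uedges G]).
Proof.
case: G => -[E D] ax; rewrite /uedges /dedges /=.
case/andP: ax => /forall_inP hE /forallP hD; split=> [e /hE/eqP //|x y xyD].
by have /forallP/(_ y)/implyP/(_ xyD)/and3P[] := hD x.
Qed.

Lemma graph_pattern (V : finType) (G : mixed_graph V) :
  pattern (joined G) (fun x y => (x, y) \in dedges G).
Proof.
have [Gu Gd] := mixed_graphP G; split.
- by move=> x y; rewrite /joined finset.setUC; congr (_ || _); exact: orbC.
- move=> x; apply/negP; rewrite /joined orbb => /orP[/Gu|/Gd[]]; last by rewrite eqxx.
  by rewrite cards2 eqxx.
- by move=> x y xyD; rewrite /joined xyD orbT.
- by move=> x y /Gd[].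
Qed.

Lemma set2_eq (T : finType) (a b x y : T) :
  [set a; b]%SET = [set x; y]%SET -> (a = x /\ b = y) \/ (a = y /\ b = x).
Proof.
move/setP => e; have := e a; have := e b; have := e x; have := e y.
rewrite !inE !eqxx !orbT /=.
by do 4![case: eqP => [?|?] //=; subst; rewrite ?eqxx //=; auto];
   do ?[case: eqP => [?|?] //=; subst; auto].
Qed.

Lemma card_uedge_pairs (V : finType) (G : mixed_graph V) :
  #|[set p : V * V | [set p.1; p.2]%SET \in uedges G]%SET| = (#|uedges G| * 2)%N.
Proof.
have [Gu _] := mixed_graphP G.
rewrite -sum1_card (partition_big (fun p : V * V => [set p.1; p.2]%SET)
  (mem (uedges G))) /=; last first.
  by move=> p; rewrite inE.
rewrite -sum_nat_const; apply: eq_bigr => e eG.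
have /eqP/cards2P[a [b [ab eE]]] := Gu e eG.
transitivity #|[set (a, b); (b, a)]%SET|; last by rewrite cards2 xpair_eqE (negPf ab).
rewrite -sum1_card; apply: eq_bigl => -[x y]; rewrite !inE /= !xpair_eqE.
apply/andP/orP => [[_ /eqP]|].
  by rewrite eE => /set2_eq[[-> ->]|[-> ->]]; rewrite !eqxx; [left|right].
by case=> /andP[/eqP-> /eqP->]; rewrite ?(finset.setUC [set b]%SET) -eE eG eqxx.
Qed.

Lemma sum_weight_graph (R : realType) (rho : R) (V : finType) (G : mixed_graph V) :
  \sum_x \sum_y weight rho (joined G) (fun x y => (x, y) \in dedges G) x y
  = 2 * (#|uedges G|%:R + rho * #|dedges G|%:R).
Proof.
have [Gu Gd] := mixed_graphP G.
(* At most one of the three indicators is nonzero, as an edge has a single type and direction. *)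
transitivity (\sum_x \sum_y (([set x; y]%SET \in uedges G)%:R +
   (rho * ((x, y) \in dedges G)%:R + rho * ((y, x) \in dedges G)%:R) : R)).
  apply: eq_bigr => x _; apply: eq_bigr => y _; rewrite /weight /joined /=.
  case xyD: ((x, y) \in dedges G).
    by have [_ /negPf-> /negPf->] := Gd _ _ xyD; rewrite /= mulr1 mulr0 add0r addr0.
  case yxD: ((y, x) \in dedges G); last by rewrite !orbF /= mulr0 !addr0.
  by have [_ _ /negPf] := Gd _ _ yxD; rewrite finset.setUC => ->; rewrite /= mulr1 mulr0 !add0r.
have sd : \sum_x \sum_y ((x, y) \in dedges G)%:R = #|dedges G|%:R :> R.
  rewrite pair_bigA /= -sum1_card natr_sum [RHS]big_mkcond /=.
  by apply: eq_bigr => -[x y] _ /=; case: ifP.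
have su : \sum_x \sum_y ([set x; y]%SET \in uedges G)%:R = 2 * #|uedges G|%:R :> R.
  rewrite mulrC -natrM -card_uedge_pairs pair_bigA /= -sum1_card natr_sum [RHS]big_mkcond /=.
  by apply: eq_bigr => -[x y] _ /=; rewrite inE /=; case: ifP.
under eq_bigr do rewrite !big_split /= -!mulr_sumr.
rewrite !big_split /= -!mulr_sumr su sd exchange_big /= sd; ring.
Qed.

Lemma density_weight (R : realType) (rho : R) (n : nat) (G : mixed_graph 'I_n) :
  (1 < n)%N ->
  (alpha R G + rho * beta R G) * (n%:R * (n%:R - 1)) =
  \sum_x \sum_y weight rho (joined G) (fun x y => (x, y) \in dedges G) x y.
Proof.
move=> n1; rewrite sum_weight_graph /alpha /beta card_ord.
have C0 : 'C(n, 2)%:R != 0 :> R by rewrite pnatr_eq0 -lt0n bin_gt0.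
have -> : n%:R * (n%:R - 1) = 2 * 'C(n, 2)%:R :> R.
  rewrite -natrM mulnC -[in 2%N]/(2`!)%N bin_ffact ffactnS ffactn1.
  by rewrite natrM -subn1 natrB 1?ltnW.
by field.
Qed.

Lemma pattern_graph (V : finType) (j d : rel V) : pattern j d ->
  exists G : mixed_graph V, joined G =2 j /\ (forall x y, ((x, y) \in dedges G) = d x y).
Proof.
case=> js ji dj da.
pose P := [pred p : V * V | [&& j p.1 p.2, ~~ d p.1 p.2 & ~~ d p.2 p.1]].
pose E := [set [set p.1; p.2]%SET | p : V * V in P]%SET.
pose D := [set p : V * V | d p.1 p.2]%SET.
have EE x y : ([set x; y]%SET \in E) = P (x, y).
  apply/imsetP/idP => [[[a b]]|Pxy]; last by exists (x, y).
  rewrite inE /= => Pab /set2_eq[[-> ->] //|[-> ->]].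
  by rewrite js andbA andbAC -andbA.
have ax : mixed_graph_axiom (E, D).
  apply/andP; split=> /=.
    apply/forall_inP => _ /imsetP[[a b] /= Pab ->]; rewrite cards2.
    by case: (eqVneq a b) Pab => [->|_ _] //; rewrite inE /= ji.
  apply/forallP => x; apply/forallP => y; apply/implyP; rewrite !inE /= => dxy.
  rewrite EE /= dxy andbF /= da //= andbT; apply: contraTneq dxy => ->.
  by apply/negP => dyy; have := da _ _ dyy; rewrite dyy.
exists (MixedGraph ax); split=> x y; last by rewrite /dedges inE.
rewrite /joined /uedges /dedges /= EE !inE /=.
case dxy: (d x y); first by rewrite /= orbT dj.
case dyx: (d y x); first by rewrite !orbT js dj.
by rewrite !orbF andbT.
Qed.

(** * Homomorphisms, copies and blow-ups *)

Lemma sub_hom (V W : finType) (F : mixed_graph V) (G : mixed_graph W) (phi : V -> W) :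
  injective phi -> is_hom F (joined G) (fun x y => (x, y) \in dedges G) phi ->
  mixed_subgraph F G.
Proof.
move=> inj /is_homP[hu hd]; apply/existsP; exists [ffun x => phi x].
apply/and3P; split.
- by apply/injectiveP => x y; rewrite !ffunE => /inj.
- apply/forallP => x; apply/forallP => y; apply/implyP; rewrite !ffunE; exact: hu.
- apply/forallP => x; apply/forallP => y; apply/implyP; rewrite !ffunE; exact: hd.
Qed.

Lemma hom_free_free (V W : finType) (F : mixed_graph V) (G : mixed_graph W) :
  hom_free F (joined G) (fun x y => (x, y) \in dedges G) -> mixed_free F G.
Proof.
move=> free; apply/negP => /existsP[phi /and3P[_ hu hd]].
have /negP := free phi; apply; apply/is_homP; split=> x y.
- by have /forallP/(_ y)/implyP := (forallP hu) x.
- by have /forallP/(_ y)/implyP := (forallP hd) x.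
Qed.

(** Replacing every vertex by [k] unjoined copies keeps F out, since a copy of F would project to a
    homomorphism. The weight sum grows as [k ^ 2], like the number of ordered pairs, so the
    tolerance in admissibility can tend to 0. *)
Lemma admissible_pattern (R : realType) (V : finType) (F : mixed_graph V)
    (rho : R) (U : finType) (j d : rel U) :
  admissible F rho -> pattern j d -> hom_free F j d ->
  \sum_x \sum_y weight rho j d x y <= (#|U|%:R : R) ^+ 2.
Proof.
move=> /admissibleP adm jd free.
have [U0|Upos] := posnP #|U|.
  by rewrite big1 ?sqr_ge0// => x _; have := fintype0 x U0.
set S := \sum_x _; apply/ler_addgt0Pr => e e0.
have U2 : 0 < (#|U|%:R : R) ^+ 2 by rewrite exprn_gt0// ltr0n.
have [N hN] := adm _ (divr_gt0 e0 U2).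
(* The shift by 2 makes [n] at least [N] and also greater than 1. *)
pose k := N.+2; pose n := #|{: 'I_k * U}|.
have nE : n = (k * #|U|)%N by rewrite /n card_prod card_ord.
have kn : (k <= n)%N by rewrite nE leq_pmulr.
pose h (a : 'I_n) : U := (enum_val a).2.
have [G [Gj Gd]] := pattern_graph (pattern_pull h jd).
have GF : mixed_free F G.
  apply: hom_free_free; apply: (hom_free_comp (h := h)) free => x y.
    by rewrite Gj.
  by rewrite Gd.
have := hN n (leq_trans (leqW (leqnSn _)) kn) G GF.
have n1 : (1 < n)%N by apply: leq_trans kn.
have := density_weight rho G n1.
have -> : \sum_x \sum_y weight rho (joined G) (fun x y => (x, y) \in dedges G) x y
   = k%:R ^+ 2 * S.
  transitivity (\sum_(a < n) \sum_(b < n) weight rho j d (h a) (h b)).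
    by do 2![apply: eq_bigr => ? _]; rewrite /weight !Gd Gj.
  transitivity (\sum_(p : 'I_k * U) \sum_(q : 'I_k * U) weight rho j d p.2 q.2).
    have bij := onW_bij predT (@enum_val_bij ('I_k * U)%type).
    rewrite [RHS](reindex _ bij); apply: eq_bigr => a _.
    by rewrite [RHS](reindex _ bij).
  rewrite -(pair_bigA _ (fun (i : 'I_k) u => \sum_(q : 'I_k * U) weight rho j d u q.2)) /=.
  rewrite sumr_const card_ord expr2 -mulrA mulr_natl; congr (_ *+ _).
  rewrite mulr_sumr; apply: eq_bigr => u _.
  rewrite -(pair_bigA _ (fun (i : 'I_k) v => weight rho j d u v)) /=.
  by rewrite sumr_const card_ord mulr_natl.
have nR : n%:R = k%:R * #|U|%:R :> R by rewrite nE natrM.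
move=> E le; have k0 : 0 < (k%:R : R) ^+ 2 by rewrite exprn_gt0// ltr0n.
rewrite -(ler_pM2l k0) -E.
have n0 : 0 <= (n%:R : R) * (n%:R - 1) by rewrite mulr_ge0// subr_ge0 ler1n ltnW.
apply: le_trans (ler_wpM2r n0 le) _.
apply: (@le_trans _ _ ((1 + e / #|U|%:R ^+ 2) * n%:R ^+ 2)).
  apply: ler_wpM2l; first by rewrite addr_ge0// divr_ge0// ltW.
  by rewrite expr2; apply: ler_wpM2l => //; rewrite lerBlDr lerDl.
rewrite nR exprMn le_eqVlt; apply/orP; left; apply/eqP; field.
by rewrite pnatr_eq0 -lt0n.
Qed.

(** * Common intersections and boxes in dense families *)

Lemma natr_card (R : realType) (T : finType) (A : {set T}) :
  #|A|%:R = \sum_x (x \in A)%:R :> R.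
Proof.
by rewrite -sum1_card natr_sum big_mkcond /=; apply: eq_bigr => a _; case: ifP.
Qed.

Lemma natr_bound (R : realType) (x : R) : exists n : nat, forall m, (n <= m)%N -> x <= m%:R.
Proof.
exists (Num.bound `|x|) => m nm; apply: le_trans (ler_norm x) _.
by apply: le_trans (ltW (archi_boundP (normr_ge0 x))) _; rewrite ler_nat.
Qed.

(* Keep a bounded number of popular sets; many points lie in [t] of them, and by
   pigeonhole many points lie in the same ones. *)
Lemma dense_common_intersection (R : realType) (delta : R) (t : nat) : 0 < delta ->
  exists n0 : nat, exists2 delta' : R, 0 < delta' &
  forall (Om T : finType) (E : T -> {set Om}), (n0 <= #|T|)%N -> (0 < #|Om|)%N ->
    delta * #|T|%:R * #|Om|%:R <= \sum_a #|E a|%:R ->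
    exists A : {set T}, (t <= #|A|)%N /\
      delta' * #|Om|%:R <= #|[set w | [forall a in A, w \in E a]]%SET|%:R.
Proof.
move=> d0.
have [L0 hL0] := natr_bound (4 * t%:R / delta).
pose L := L0.+1; have := hL0 L (leqnSn _).
rewrite ler_pdivrMr// => hL {hL0}.
have [n0 hn0] := natr_bound (2 * L%:R / delta).
pose delta' := delta / 8 / (2 ^ L)%:R.
have p0 : 0 < (2 ^ L)%:R :> R by rewrite ltr0n expn_gt0.
exists n0, delta'; first by rewrite !divr_gt0.
move=> Om T E /hn0; rewrite ler_pdivrMr// => nT Om0 dE.
have o0 : 0 < #|Om|%:R :> R by rewrite ltr0n.
(* Unpopular indices carry at most half of the total, which leaves at least [L] popular ones. *)
pose B := [set a | delta / 2 * #|Om|%:R <= #|E a|%:R]%SET.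
have LB : (L <= #|B|)%N.
  rewrite -(ler_nat R) -(ler_pM2r o0).
  suff : \sum_a #|E a|%:R <= (#|B|%:R + #|T|%:R * (delta / 2)) * #|Om|%:R by nra.
  have -> : (#|B|%:R + #|T|%:R * (delta / 2)) * #|Om|%:R =
     \sum_a ((a \in B)%:R * #|Om|%:R + delta / 2 * #|Om|%:R) :> R.
    rewrite big_split /= -mulr_suml -natr_card sumr_const -[_ *+ _]mulr_natl; ring.
  apply: ler_sum => a _; case: (boolP (a \in B)) => [_|].
    rewrite mul1r; apply: ler_wpDr; last by rewrite ler_nat max_card.
    by rewrite mulr_ge0// divr_ge0// ltW.
  by rewrite inE -ltNge mul0r add0r => /ltW.
pose S := [set a in take L (enum B)]%SET.
have SB a : a \in S -> a \in B by rewrite inE => /mem_take; rewrite mem_enum.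
have cS : #|S| = L.
  by rewrite cardsE (card_uniqP _) ?size_takel ?take_uniq ?enum_uniq// -cardE.
pose C w := [set a in S | w \in E a]%SET.
pose good := [set w | (t <= #|C w|)%N]%SET.
have CE : \sum_(a in S) #|E a|%:R = \sum_w #|C w|%:R :> R.
  transitivity (\sum_(a in S) \sum_w (w \in E a)%:R : R).
    by apply: eq_bigr => a _; rewrite natr_card.
  rewrite exchange_big; apply: eq_bigr => w _.
  rewrite natr_card big_mkcond /=.
  by apply: eq_bigr => a _; rewrite [in RHS]inE; case: ifP.
(* Count incidences with the [L] kept sets: a bad point lies in fewer than [t <= L * delta / 4] of
   them, so good points carry the rest. *)
have gE : delta / 4 * #|Om|%:R <= #|good|%:R.
  have : L%:R * (delta / 2 * #|Om|%:R) <= \sum_w #|C w|%:R.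
    rewrite -CE -cS mulr_natl -sumr_const; apply: ler_sum => a /SB.
    by rewrite inE.
  have : \sum_w #|C w|%:R <= \sum_w (t%:R + L%:R * (w \in good)%:R) :> R.
    apply: ler_sum => w _; rewrite inE; case: leqP => h.
      rewrite mulr1 ler_wpDl// ler_nat -cS; apply/subset_leq_card.
      by apply/fintype.subsetP => a; rewrite inE => /andP[].
    by rewrite mulr0 addr0 ler_nat ltnW.
  rewrite big_split /= sumr_const -mulr_sumr -natr_card -[t%:R *+ _]mulr_natl.
  have L0' : 0 < L%:R :> R by rewrite ltr0n.
  by move=> h1 h2; rewrite -(ler_pM2l L0'); nra.
(* If every class of equal [C w] were small, the at most [2 ^ L] classes would cover only
   [delta / 8] of the points, against [delta / 4]. *)
apply: contrapT => none.
have : #|good|%:R <= \sum_(A in powerset S) delta' * #|Om|%:R.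
  rewrite -sum1_card (partition_big C (mem (powerset S))) /=; last first.
    by move=> w _; rewrite powersetE; apply/fintype.subsetP => a; rewrite inE => /andP[].
  rewrite natr_sum; apply: ler_sum => A _; rewrite sum1_card leNgt; apply/negP => lt.
  have /card_gt0P[w /andP[]] : (0 < #|[pred w | w \in good & C w == A]|)%N.
    rewrite -(ltr_nat R); apply: le_lt_trans lt.
    by rewrite !mulr_ge0// ?invr_ge0// ltW.
  rewrite inE => tC /eqP CA; apply: none; exists A; split; first by rewrite -CA.
  apply: le_trans (ltW lt) _; rewrite ler_nat; apply: subset_leq_card.
  apply/fintype.subsetP => v /andP[_ /eqP <-]; rewrite inE.
  by apply/forall_inP => a; rewrite inE => /andP[].
rewrite sumr_const card_powerset cS -[leRHS]mulr_natl mulrA /delta'.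
have -> : (2 ^ L)%:R * (delta / 8 / (2 ^ L)%:R) = delta / 8 by field; rewrite lt0r_neq0.
by nra.
Qed.

Definition upd (U : finType) (T : Type) (i : U) (a : T) (psi : {ffun U -> T}) :=
  [ffun k => if k == i then a else psi k].

(* [(a, psi) |-> (psi i, upd i a psi)] is an involution. *)
Lemma sum_upd (R : realType) (U T : finType) (i : U) (h : {ffun U -> T} -> R) :
  (\sum_psi h psi) *+ #|T| = \sum_psi \sum_a h (upd i a psi).
Proof.
rewrite exchange_big /= (pair_bigA _ (fun a psi => h (upd i a psi))) /=.
pose sw (p : T * {ffun U -> T}) := (p.2 i, upd i p.1 p.2).
have swK : involutive sw.
  case=> a psi; rewrite /sw /= ffunE eqxx; congr pair.
  by apply/ffunP => k; rewrite !ffunE; case: eqP => [->|].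
rewrite (reindex_inj (inv_inj swK)) /=.
transitivity (\sum_(p : T * {ffun U -> T}) h p.2).
  by rewrite -(pair_bigA _ (fun (a : T) psi => h psi)) /= sumr_const.
by apply: eq_bigr => -[a psi] _ /=; have [_ ->] := swK (a, psi).
Qed.

(** The previous result for the sets of [psi] with [upd i a psi] in [E], indexed by [a]; by
    [sum_upd] their average size is that of [E]. *)
Lemma dense_fiber (R : realType) (delta : R) (t : nat) : 0 < delta ->
  exists n0 : nat, exists2 delta' : R, 0 < delta' &
  forall (U T : finType) (i : U) (E : {set {ffun U -> T}}), (n0 < #|T|)%N ->
    delta * #|{ffun U -> T}|%:R <= #|E|%:R ->
    exists A : {set T}, (t <= #|A|)%N /\
      delta' * #|{ffun U -> T}|%:R
      <= #|[set psi | [forall a in A, upd i a psi \in E]]%SET|%:R.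
Proof.
move=> d0; have [n0 [d' d'0 h]] := dense_common_intersection t d0.
exists n0, d' => // U T i E nT dE.
have := h {ffun U -> T} T (fun a => [set psi | upd i a psi \in E]%SET) (ltnW nT).
case.
- by rewrite card_ffun expn_gt0; rewrite (leq_ltn_trans (leq0n _) nT).
- suff -> : \sum_a #|[set psi | upd i a psi \in E]%SET|%:R = #|T|%:R * #|E|%:R :> R.
    by rewrite -mulrA mulrCA; apply: ler_wpM2l.
  rewrite mulr_natl natr_card (sum_upd i) exchange_big; apply: eq_bigr => a _.
  by rewrite natr_card; apply: eq_bigr => psi _; rewrite inE.
- move=> A [tA lA]; exists A; split=> //; apply: le_trans lA _.
  rewrite ler_nat; apply: subset_leq_card; apply/fintype.subsetP => psi.
  rewrite !inE => /forall_inP H; apply/forall_inP => a /H.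
  by rewrite inE.
Qed.

(* Erdos' theorem on complete multipartite subhypergraphs: coordinates are made
   free one at a time. *)
Lemma dense_box (R : realType) (U : finType) (delta : R) (t : nat) : 0 < delta ->
  exists n0 : nat, forall (T : finType), (n0 < #|T|)%N ->
  forall E : {set {ffun U -> T}}, delta * #|{ffun U -> T}|%:R <= #|E|%:R ->
  exists A : U -> {set T}, (forall i, (t <= #|A i|)%N) /\
    forall psi : {ffun U -> T}, (forall i, psi i \in A i) -> psi \in E.
Proof.
(* Generalised for induction: coordinates in [s] range over the box, the others come from any [psi]
   in [E'], whose density makes it nonempty at the end. *)
suff main (s : seq U) : uniq s -> forall delta : R, 0 < delta ->
    exists n0 : nat, exists2 delta' : R, 0 < delta' &
    forall (T : finType), (n0 < #|T|)%N ->
    forall E : {set {ffun U -> T}}, delta * #|{ffun U -> T}|%:R <= #|E|%:R ->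
    exists A : U -> {set T}, exists E' : {set {ffun U -> T}},
    [/\ delta' * #|{ffun U -> T}|%:R <= #|E'|%:R,
        forall i, i \in s -> (t <= #|A i|)%N &
        forall psi psi' : {ffun U -> T}, psi \in E' ->
          (forall i, i \in s -> psi' i \in A i) ->
          [ffun i => if i \in s then psi' i else psi i] \in E].
  move=> d0; have [n0 [d' d'0 h]] := main (enum U) (enum_uniq _) _ d0.
  exists n0 => T nT E /(h T nT)[A [E' [dE' tA AE]]]; exists A; split=> [i|psi' hpsi'].
    by apply: tA; rewrite mem_enum.
  have /card_gt0P[psi psiE'] : (0 < #|E'|)%N.
    rewrite -(ltr_nat R); apply: lt_le_trans dE'; rewrite mulr_gt0// ltr0n.
    by rewrite card_ffun expn_gt0 (leq_ltn_trans (leq0n _) nT).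
  have := AE psi psi' psiE' (fun i _ => hpsi' i).
  by congr (_ \in E); apply/ffunP => i; rewrite ffunE mem_enum.
elim: s => [_ {}delta d0|i s IH /= /andP[is_ us] {}delta d0].
  exists 0%N, delta => // T _ E dE; exists (fun=> finset.set0), E; split=> // psi psi' psiE _.
  by rewrite (_ : finfun _ = psi)//; apply/ffunP => k; rewrite ffunE.
have [n1 [d1 d10 h1]] := dense_fiber t d0.
have [n2 [d2 d20 h2]] := IH us _ d10.
exists (maxn n1 n2), d2 => // T; rewrite gtn_max => /andP[nT1 nT2] E dE.
have [Ai [tAi dE1]] := h1 U T i E nT1 dE.
have [A [E' [dE' tA AE]]] := h2 T nT2 _ dE1.
exists (fun k => if k == i then Ai else A k), E'; split=> // [k|psi psi' psiE' hpsi'].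
  by rewrite inE; case: eqP => //= _ /tA.
have sA k : k \in s -> psi' k \in A k.
  move=> ks; have := hpsi' k; rewrite inE ks orbT => /(_ isT).
  by case: eqP => // ki; rewrite -ki ks in is_.
have := AE _ _ psiE' sA; rewrite inE => /forall_inP/(_ (psi' i)).
have := hpsi' i; rewrite mem_head eqxx => /(_ isT) -> /(_ isT).
congr (_ \in E); apply/ffunP => k; rewrite !ffunE inE.
by case: eqP => [->|].
Qed.

(** * Sampling and supersaturation *)

Lemma injective_choice (V T : finType) (A : V -> {set T}) :
  (forall x, (#|V| <= #|A x|)%N) ->
  exists phi : V -> T, injective phi /\ forall x, phi x \in A x.
Proof.
move=> cA.
suff main (s : seq V) : uniq s -> exists phi : V -> T,
    {in s &, injective phi} /\ forall x, phi x \in A x.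
  have [phi [inj hphi]] := main (enum V) (enum_uniq _).
  by exists phi; split=> // x y; apply: inj; rewrite mem_enum.
elim: s => [_|x s IH /= /andP[xs us]].
  have : forall x, exists y, y \in A x.
    by move=> x; apply/card_gt0P/(leq_trans _ (cA x)); apply/card_gt0P; exists x.
  by case/fin_all_exists => phi hphi; exists phi; split.
have [phi [inj hphi]] := IH us.
(* Greedy choice: [s] misses [x], so fewer than [#|V|] values are taken. *)
have [y /andP[yA ys]] : exists y, (y \in A x) && (y \notin map phi s).
  apply/existsP; apply: contraT => /existsPn h.
  have : (#|A x| <= #|map phi s|)%N.
    apply/subset_leq_card/fintype.subsetP => y yA.
    by have := h y; rewrite yA /= negbK.
  rewrite leqNgt => /negP[]; apply: leq_trans (cA x).
  apply: leq_ltn_trans (card_size _) _; rewrite size_map -(card_uniqP us).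
  by apply: proper_card; apply/properP; split; [apply/fintype.subsetP|exists x].
exists (fun k => if k == x then y else phi k); split=> [a b|k]; last first.
  by case: eqP => [->|].
rewrite !inE; case: (eqVneq a x) => [->|ax] /=; case: (eqVneq b x) => [->|bx] //=.
- by move=> _ bs e; case/negP: ys; rewrite e map_f.
- by move=> as_ _ e; case/negP: ys; rewrite -e map_f.
- exact: inj.
Qed.

(** For a uniformly random [psi], the values at two distinct coordinates are independent and
    uniform. *)
Lemma sum_pair_sample (R : realType) (U T : finType) (i k : U) (w : T -> T -> R) :
  i != k ->
  (\sum_(psi : {ffun U -> T}) w (psi i) (psi k)) * #|T|%:R ^+ 2 =
  #|{ffun U -> T}|%:R * \sum_a \sum_b w a b.
Proof.
move=> ik; rewrite expr2 mulrA !mulr_natr (sum_upd i) (sum_upd k) mulr_natl.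
rewrite -sumr_const; apply: eq_bigr => psi _; rewrite exchange_big /=.
apply: eq_bigr => a _; apply: eq_bigr => b _.
by rewrite !ffunE !eqxx [k == i]eq_sym (negPf ik).
Qed.

Lemma pigeonhole_sum (R : realType) (I : finType) (c : R) (x : I -> R) :
  (0 < #|I|)%N -> c * #|I|%:R <= \sum_i x i -> exists i, c <= x i.
Proof.
move=> /card_gt0P[i0 _] le; apply: contrapT => /forallNP none.
have : \sum_i x i < \sum_(i : I) c.
  apply: ltr_sum => [|i _]; first by apply/hasP; exists i0; rewrite ?mem_index_enum.
  by rewrite ltNge; apply/negP; exact: none.
by rewrite sumr_const -[ltRHS]mulr_natr ltNge le.
Qed.

Lemma weight_le (R : realType) (rho : R) (U : Type) (j d : rel U) x y :
  1 <= rho -> weight rho j d x y <= rho.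
Proof.
move=> rho1; rewrite /weight; case: ifP => // _; apply: le_trans rho1.
by case: (j x y).
Qed.

(** [f] may identify vertices of F, but never the two ends of an edge, since their images are joined
    and no vertex is joined to itself. So any injective choice of [phi x] in [A (f x)] works: each
    edge is tested on a point of the box that agrees with [phi] at both ends. *)
Lemma box_mixed_subgraph (V W U : finType) (F : mixed_graph V)
    (G : mixed_graph W) (f : V -> U) (A : U -> {set W}) :
  (forall i, (#|V| < #|A i|)%N) ->
  (forall psi : {ffun U -> W}, (forall i, psi i \in A i) ->
     is_hom F (joined G) (fun x y => (x, y) \in dedges G) (psi \o f)) ->
  mixed_subgraph F G.
Proof.
move=> cA hA; have [_ ji dj _] := graph_pattern G.
have : forall i, exists w, w \in A i.
  by move=> i; apply/card_gt0P; exact: leq_ltn_trans (cA i).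
case/fin_all_exists => psi0 psi0A.
have [phi [inj phiA]] := injective_choice (fun x => ltnW (cA (f x))).
apply: (sub_hom inj).
pose psi x y := upd (f x) (phi x) (upd (f y) (phi y) (finfun psi0)).
have psiP x y : is_hom F (joined G) (fun x y => (x, y) \in dedges G) (psi x y \o f).
  apply: hA => i; rewrite /psi ffunE; case: eqP => [->//|_].
  by rewrite ffunE; case: eqP => [->//|_]; rewrite ffunE.
have psix x y : psi x y (f x) = phi x by rewrite /psi ffunE eqxx.
have psiy x y : f x != f y -> psi x y (f y) = phi y.
  by move=> fxy; rewrite /psi !ffunE eq_sym (negPf fxy) eqxx.
have nej x y : joined G (psi x y (f x)) (psi x y (f y)) -> f x != f y.
  by apply: contraTneq => ->; rewrite ji.
apply/is_homP; split=> x y xy; have /is_homP[hu hd] := psiP x y.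
  by have jxy := hu _ _ xy; rewrite -(psix x y) -(psiy x y)//; exact: nej jxy.
have dxy := hd _ _ xy.
by rewrite -(psix x y) -(psiy x y)//; exact: nej (dj _ _ dxy).
Qed.

(* Supersaturation: sample [psi : 'I_M -> 'I_n]. If the density of G exceeds
   1 + e, a positive fraction of the samples contain a homomorphic image of F,
   and a dense box of such samples contains an injective copy of F. *)
Lemma patterns_admissible (R : realType) (V : finType) (F : mixed_graph V) (rho : R) :
  1 <= rho ->
  (forall M (j d : rel 'I_M), pattern j d -> hom_free F j d ->
     \sum_x \sum_y weight rho j d x y <= (M%:R : R) ^+ 2) ->
  admissible F rho.
Proof.
move=> rho1 H; apply/admissibleP => e e0.
have rho0 : 0 < rho by exact: lt_le_trans rho1.
(* [M], and below [n], are so large that the factors [(M - 1) / M] and [(n - 1) / n] reduce [1 + e]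
   only to [1 + e / 2], then to [1 + e / 4]. *)
have [M0 /(_ M0.+2 (leqW (leqnSn _)))] := natr_bound (2 * (1 + e) / e).
set M := M0.+2; rewrite ler_pdivrMr// => hM.
pose NF := #|{ffun V -> 'I_M}|.
have NF0 : (0 < NF)%N by rewrite /NF card_ffun card_ord expn_gt0.
(* The samples in [E] below have density at least [e / (4 * rho)]; dividing by [NF] prepares the
   pigeonhole over the maps [f]. *)
pose delta : R := e / (4 * rho * NF%:R).
have delta0 : 0 < delta by rewrite divr_gt0// !mulr_gt0// ltr0n.
have [n1 hn1] := dense_box 'I_M #|V|.+1 delta0.
have [n2 hn2] := natr_bound (4 * (1 + e / 2) / e).
exists (maxn n1.+2 n2) => n; rewrite geq_max => /andP[nn1 /hn2].
rewrite ler_pdivrMr// => hn G FG; rewrite leNgt; apply/negP => big.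
have n_gt1 : (1 < n)%N by apply: leq_trans nn1.
have n0 : 1 < n%:R :> R by rewrite ltr1n.
pose jG := joined G; pose dG := fun x y => (x, y) \in dedges G.
have jd : pattern jG dG := graph_pattern G.
pose S := \sum_x \sum_y weight rho jG dG x y.
have SE : (1 + e) * (n%:R * (n%:R - 1)) < S.
  rewrite /S -density_weight// ltr_pM2r// mulr_gt0// ?subr_gt0//.
  by apply: lt_trans n0.
pose Om := {ffun 'I_M -> 'I_n}.
have Om0 : 0 < #|{: Om}|%:R :> R by rewrite ltr0n card_ffun expn_gt0 card_ord (ltnW n_gt1).
pose E := [set psi : Om | [exists f : {ffun V -> 'I_M}, is_hom F jG dG (psi \o f)]]%SET.
pose Ws (psi : Om) := \sum_i \sum_k weight rho jG dG (psi i) (psi k).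
have WsE : (\sum_psi Ws psi) * n%:R ^+ 2 = M%:R * (M%:R - 1) * (#|{: Om}|%:R * S).
  rewrite exchange_big /= mulr_suml.
  transitivity (\sum_(i < M) (M%:R - 1) * (#|{: Om}|%:R * S)); last first.
    by rewrite sumr_const card_ord -[LHS]mulr_natl [LHS]mulrA.
  apply: eq_bigr => i _; rewrite exchange_big /= mulr_suml (bigD1 i) //=.
  rewrite big1 ?mul0r ?add0r; last first.
    move=> psi _; have [_ ji dj _] := jd; rewrite /weight ji.
    case: ifP => //; rewrite orbb => /dj; by rewrite ji.
  under eq_bigr => k ki do
    rewrite -[in n%:R](card_ord n) sum_pair_sample 1?eq_sym//.
  rewrite sumr_const -[LHS]mulr_natl; congr (_ * _).
  by rewrite (cardC1 i) card_ord /M /= -[in RHS]natr1 addrK.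
(* A sample outside [E] induces a pattern to which F has no homomorphism, so [H] applies; on [E]
   every weight is bounded by [rho]. *)
have WsLe psi : Ws psi <= M%:R ^+ 2 + rho * M%:R ^+ 2 * (psi \in E)%:R.
  case: (boolP (psi \in E)) => psiE /=.
    rewrite mulr1 ler_wpDl ?sqr_ge0//.
    apply: (@le_trans _ _ (\sum_(i < M) \sum_(k < M) rho)).
      by apply: ler_sum => i _; apply: ler_sum => k _; exact: weight_le.
    by rewrite !sumr_const card_ord -mulrnA -[leLHS]mulr_natr natrM expr2.
  rewrite mulr0 addr0.
  apply: H; [exact: (pattern_pull psi jd)|move=> phi].
  apply: contra psiE => hphi; rewrite inE; apply/existsP; exists (finfun phi).
  by rewrite (_ : psi \o finfun phi = psi \o phi)//; apply/funext => x /=; rewrite ffunE.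
have EE : e / (4 * rho) * #|{: Om}|%:R <= #|E|%:R.
  have : \sum_psi Ws psi <= #|{: Om}|%:R * M%:R ^+ 2 + rho * M%:R ^+ 2 * #|E|%:R.
    rewrite natr_card mulr_sumr mulr_natl -sumr_const -big_split /=.
    by apply: ler_sum => psi _; exact: WsLe.
  have m0 : 0 < M%:R :> R by rewrite ltr0n.
  have hM' : M%:R * (1 + e / 2) <= (M%:R - 1) * (1 + e) by lra.
  have hn' : n%:R * (1 + e / 4) <= (1 + e / 2) * (n%:R - 1) by lra.
  have low : M%:R ^+ 2 * n%:R ^+ 2 * (1 + e / 4) * #|{: Om}|%:R <= (\sum_psi Ws psi) * n%:R ^+ 2.
    rewrite WsE [#|{: Om}|%:R * S]mulrC [leRHS]mulrA ler_pM2r//.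
    have N0 : 0 <= n%:R :> R by [].
    apply: (@le_trans _ _ (M%:R * (M%:R - 1) * ((1 + e) * (n%:R * (n%:R - 1))))); last first.
      by rewrite ler_wpM2l ?ltW// mulr_gt0// subr_gt0 ltr1n.
    apply: (@le_trans _ _ (M%:R * (M%:R * (1 + e / 2)) * (n%:R * (n%:R - 1)))).
      have -> : M%:R ^+ 2 * n%:R ^+ 2 * (1 + e / 4) =
        M%:R ^+ 2 * n%:R * (n%:R * (1 + e / 4)) :> R by ring.
      have -> : M%:R * (M%:R * (1 + e / 2)) * (n%:R * (n%:R - 1)) =
        M%:R ^+ 2 * n%:R * ((1 + e / 2) * (n%:R - 1)) :> R by ring.
      by rewrite ler_wpM2l// mulr_ge0// sqr_ge0.
    have -> : M%:R * (M%:R - 1) * ((1 + e) * (n%:R * (n%:R - 1))) =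
       M%:R * ((M%:R - 1) * (1 + e)) * (n%:R * (n%:R - 1)) :> R by ring.
    by rewrite ler_wpM2r ?ler_wpM2l// mulr_ge0// subr_ge0 ltW.
  move=> up.
  have n20 : 0 < n%:R ^+ 2 :> R by rewrite exprn_gt0// (lt_trans _ n0).
  have m20 : 0 < M%:R ^+ 2 :> R by rewrite exprn_gt0.
  have := le_trans low (ler_wpM2r (ltW n20) up).
  rewrite [leLHS](_ : _ = M%:R ^+ 2 * ((1 + e / 4) * #|{: Om}|%:R) * n%:R ^+ 2); last by ring.
  rewrite ler_pM2r// [leRHS](_ : _ = M%:R ^+ 2 * (#|{: Om}|%:R + rho * #|E|%:R)); last by ring.
  rewrite ler_pM2l// => fin.
  rewrite -(ler_pM2l rho0) [leLHS](_ : _ = e / 4 * #|{: Om}|%:R); first lra.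
  by field; rewrite lt0r_neq0.
have [f hf] : exists f : {ffun V -> 'I_M},
    delta * #|{: Om}|%:R <= #|[set psi : Om | is_hom F jG dG (psi \o f)]%SET|%:R.
  apply: pigeonhole_sum => //.
  apply: (@le_trans _ _ #|E|%:R).
    apply: le_trans EE; rewrite /delta -/NF le_eqVlt; apply/orP; left; apply/eqP.
    by field; rewrite !lt0r_neq0// ltr0n.
  rewrite natr_card; under [leRHS]eq_bigr do rewrite natr_card.
  rewrite [leRHS]exchange_big /=; apply: ler_sum => psi _; rewrite inE.
  case: existsP => [[f hf]|_]; last exact: sumr_ge0.
  by rewrite (bigD1 f) //= inE hf lerDl sumr_ge0.
have nT : (n1 < #|'I_n|)%N by rewrite card_ord (leq_trans _ nn1).
have [A [cA hA]] := hn1 _ nT _ hf.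
case/negP: FG; apply: (box_mixed_subgraph (f := f) cA) => psi psiA.
by have := hA _ psiA; rewrite inE.
Qed.

(** * Quadratic forms and Zykov symmetrization *)

Definition bform (R : realType) (U : finType) (A : U -> U -> R) (x y : U -> R) : R :=
  \sum_i \sum_k A i k * (x i * y k).

Notation qform A x := (bform A x x).

Definition adj (R : realType) (U : Type) (d : rel U) (i k : U) : R :=
  (d i k || d k i)%:R.

Definition neq_rel (U : eqType) : rel U := fun x y => x != y.

Lemma weight_sym (R : realType) (rho : R) (U : Type) (j d : rel U) i k :
  pattern j d -> weight rho j d i k = weight rho j d k i.
Proof. by case=> js _ _ _; rewrite /weight orbC js. Qed.

Lemma weight_nonadjacent (R : realType) (rho : R) (U : Type) (j d : rel U) i k :
  pattern j d -> ~~ j i k -> weight rho j d i k = 0.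
Proof.
case=> js _ dj _ jik; rewrite /weight (negPf jik) ifF//.
by apply/negP => /orP[] /dj; rewrite ?(negPf jik)// js (negPf jik).
Qed.

Lemma sum_delta (R : realType) (U : finType) (f : U -> R) (i : U) :
  \sum_k f k * (k == i)%:R = f i.
Proof.
rewrite (bigD1 i) //= eqxx mulr1 big1 ?addr0// => k /negPf->.
by rewrite mulr0.
Qed.

(** There is no term in [s ^ 2]: the direction [e_i - e_j] only meets the entries of [A] at [i] and
    [j], all zero. *)
Lemma qform_shift (R : realType) (U : finType) (A : U -> U -> R) (x : U -> R)
    (i j : U) (s : R) :
  (forall a b, A a b = A b a) -> A i i = 0 -> A j j = 0 -> A i j = 0 ->
  let y k := x k + s * ((k == i)%:R - (k == j)%:R) in
  qform A y = qform A x + 2 * s * (\sum_k A i k * x k - \sum_k A j k * x k).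
Proof.
move=> As Aii Ajj Aij y; pose z k : R := (k == i)%:R - (k == j)%:R.
have zl (f : U -> R) : \sum_k f k * z k = f i - f j.
  rewrite -(sum_delta f i) -(sum_delta f j) -sumrB.
  by apply: eq_bigr => k _; rewrite mulrBr.
have bz w : bform A z w = \sum_k A i k * w k - \sum_k A j k * w k.
  rewrite /bform -(zl (fun a => \sum_k A a k * w k)); apply: eq_bigr => a _.
  by rewrite mulr_suml; apply: eq_bigr => k _; rewrite [z a * _]mulrC mulrA.
have bC w : bform A w z = bform A z w.
  rewrite /bform exchange_big; apply: eq_bigr => a _; apply: eq_bigr => b _.
  by rewrite As [w b * _]mulrC.
have zz : bform A z z = 0 by rewrite bz !zl As [A j i]As Aii Ajj Aij !subrr.
rewrite -bz; transitivity (qform A x + s * bform A x z + s * bform A z x + s ^+ 2 * qform A z).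
  rewrite /bform !mulr_sumr -!big_split /=; apply: eq_bigr => a _.
  rewrite !mulr_sumr -!big_split /=; apply: eq_bigr => b _.
  by rewrite /y -/(z a) -/(z b); ring.
by rewrite zz bC; ring.
Qed.

(* Zykov symmetrization: between two non-adjacent vertices the form is linear,
   so all the mass of one of them can be moved to the other. *)
Lemma clique_support (R : realType) (rho : R) (U : finType) (j d : rel U)
    (x : U -> R) :
  pattern j d -> (forall i, 0 <= x i) ->
  exists y : U -> R, [/\ forall i, 0 <= y i, \sum_i y i = \sum_i x i,
    qform (weight rho j d) x <= qform (weight rho j d) y &
    forall i k, y i != 0 -> y k != 0 -> i != k -> j i k].
Proof.
move=> jd; set A := weight rho j d.
have As a b : A a b = A b a by exact: weight_sym.
have A0 a b : ~~ j a b -> A a b = 0 by exact: weight_nonadjacent.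
have Aii a : A a a = 0 by apply: A0; case: jd => _ ->.
(* Induction on the size of the support, which every move of mass decreases. *)
have [n] := ubnP #|[set i | x i != 0]%SET|; elim: n x => // n IH x xn x0.
pose g i := \sum_k A i k * x k.
(* By symmetry, mass may be assumed to move towards the vertex with the larger gradient entry
   [g]. *)
suff shift i k : x i != 0 -> x k != 0 -> i != k -> ~~ j i k -> g k <= g i ->
  exists y : U -> R, [/\ forall i, 0 <= y i, \sum_i y i = \sum_i x i,
    qform A x <= qform A y &
    forall i k, y i != 0 -> y k != 0 -> i != k -> j i k].
  case: (pselect (exists i k, [/\ x i != 0, x k != 0, i != k & ~~ j i k])).
    case=> i [k [xi xk ik jik]]; case: (leP (g k) (g i)) => [|/ltW] gik.
      exact: (shift i k).
    by apply: (shift k i) => //; rewrite 1?eq_sym//; case: jd => ->.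
  move=> none; exists x; split=> // i k xi xk ik; apply: contrapT => /negP jik.
  by apply: none; exists i, k.
move=> xi xk ik jik gki.
pose y a := x a + x k * ((a == i)%:R - (a == k)%:R).
have yE a : y a = if a == k then 0 else if a == i then x i + x k else x a.
  rewrite /y; case: (eqVneq a k) => [->|ak].
    by rewrite eq_sym (negPf ik) sub0r mulrN1 subrr.
  by case: eqP => [->|_]; rewrite subr0 ?mulr1 ?mulr0 ?addr0.
have y0 a : 0 <= y a by rewrite yE; case: eqP => // _; case: eqP => // _; rewrite addr_ge0.
have [|//|w [w0 ws wq wc]] := IH y.
  rewrite ltnS in xn; apply: leq_trans xn; apply: proper_card; apply/properP; split.
    apply/fintype.subsetP => a; rewrite !inE yE; case: (eqVneq a k) => [_|_]; first by rewrite eqxx.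
    by case: (eqVneq a i) => [->|].
  by exists k; rewrite !inE ?yE ?eqxx.
exists w; split=> //.
  rewrite ws /y big_split /= -mulr_sumr sumrB.
  have s1 a : \sum_b (b == a)%:R = 1 :> R.
    by rewrite (bigD1 a) //= eqxx big1 ?addr0// => b /negPf->.
  by rewrite !s1 subrr mulr0 addr0.
apply: le_trans wq; rewrite /y qform_shift// ?A0//.
by rewrite lerDl mulr_ge0 ?subr_ge0// mulr_ge0.
Qed.

(** The weight matrix of a complete pattern is [J - I + (rho - 1) B], with [J] the all-ones matrix
    and [B] the symmetrized adjacency matrix. *)
Lemma qform_complete (R : realType) (rho : R) (U : finType) (d : rel U) (x : U -> R) :
  pattern (@neq_rel U) d ->
  qform (weight rho (@neq_rel U) d) x =
  (\sum_i x i) ^+ 2 - \sum_i x i ^+ 2 + (rho - 1) * qform (adj R d) x.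
Proof.
case=> _ ji dj _; rewrite expr2 mulr_suml -sumrB /bform mulr_sumr -big_split /=.
apply: eq_bigr => i _; rewrite !mulr_sumr expr2 -(sum_delta (fun k => x i * x k)).
rewrite -sumrB -big_split /=; apply: eq_bigr => k _.
rewrite /weight /adj /neq_rel eq_sym; case: (eqVneq i k) => [->|ik].
  have dkk : d k k = false by apply/negP => /dj; rewrite ji.
  by rewrite dkk /=; ring.
by case: ifP => _ /=; ring.
Qed.

Lemma sum_support (R : realType) (U : finType) (S : {set U}) (f : U -> R) :
  (forall i, i \notin S -> f i = 0) ->
  \sum_i f i = \sum_(a < #|S|) f (enum_val a).
Proof.
move=> f0; rewrite -(big_enum_val f) [RHS]big_mkcond.
by apply: eq_bigr => i _; case: ifPn => // /f0.
Qed.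

(** A weight sum on [M] vertices is the form at the all-ones vector. Symmetrization keeps the total
    mass [M] and makes the support complete; there the squared mass gives [M ^ 2] and the hypothesis
    makes the remainder nonpositive. *)
Lemma complete_admissible (R : realType) (V : finType) (F : mixed_graph V) (rho : R) :
  1 <= rho ->
  (forall k (d : rel 'I_k), pattern (@neq_rel 'I_k) d ->
     hom_free F (@neq_rel 'I_k) d -> forall x : 'I_k -> R, (forall i, 0 <= x i) ->
     (rho - 1) * qform (adj R d) x <= \sum_i x i ^+ 2) ->
  admissible F rho.
Proof.
move=> rho1 H; apply: patterns_admissible => // M j d jd free.
have [y [y0 ys yq yc]] := clique_support rho jd (fun _ : 'I_M => ler01 : 0 <= (1 : R)).
have -> : \sum_a \sum_b weight rho j d a b = qform (weight rho j d) (fun=> 1).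
  by do 2![apply: eq_bigr => ? _]; rewrite !mulr1.
apply: le_trans yq _.
have -> : M%:R = \sum_i y i :> R by rewrite ys sumr_const card_ord.
pose S := [set i | y i != 0]%SET.
have yS i : i \notin S -> y i = 0 by rewrite inE negbK => /eqP.
pose h (a : 'I_#|S|) := enum_val a.
have hj a b : neq_rel a b = j (h a) (h b).
  apply/idP/idP => [ab|].
    have := enum_valP a; have := enum_valP b; rewrite !inE => yb ya.
    by apply: yc => //; rewrite (inj_eq enum_val_inj).
  by apply: contraTneq => ->; case: jd => _ ->.
pose d' a b := d (h a) (h b).
have jd' : pattern (@neq_rel 'I_#|S|) d'.
  have [js ji dj da] := pattern_pull h jd.
  split=> [a b|a|a b|a b]; rewrite ?hj; [exact: js|exact: ji|exact: dj|exact: da].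
have free' : hom_free F (@neq_rel 'I_#|S|) d'.
  by apply: (hom_free_comp (h := h)) free => a b //; rewrite hj.
have -> : qform (weight rho j d) y = qform (weight rho (@neq_rel 'I_#|S|) d') (y \o h).
  rewrite /bform (sum_support (S := S)) => [|i /yS ->]; last first.
    by apply: big1 => k _; rewrite mul0r mulr0.
  apply: eq_bigr => a _; rewrite (sum_support (S := S)) => [|i /yS ->]; last first.
    by rewrite !mulr0.
  by apply: eq_bigr => b _; rewrite /weight /d' hj.
rewrite (sum_support yS) qform_complete// -[leRHS]addr0 -addrA lerD2l addrC subr_le0.
by apply: H => // i; exact: y0.
Qed.

(** * Admissibility as a bound on quadratic forms *)

Lemma sum_tag (R : realType) (U : finType) (J : U -> finType) (f : U -> R) :
  \sum_(p : {u : U & J u}) f (tag p) = \sum_u f u * #|J u|%:R.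
Proof.
transitivity (\sum_u \sum_(w : J u) f u); first by rewrite sig_big_dep.
by apply: eq_bigr => u _; rewrite sumr_const mulr_natr.
Qed.

(** Blow vertex [i] up into [x i] copies: the weight sum becomes the form at [x], and the squared
    number of vertices cancels against its term [J]. *)
Lemma admissible_complete_nat (R : realType) (V : finType) (F : mixed_graph V)
    (rho : R) (U : finType) (d : rel U) (x : U -> nat) :
  admissible F rho -> pattern (@neq_rel U) d -> hom_free F (@neq_rel U) d ->
  (rho - 1) * qform (adj R d) (fun i => (x i)%:R) <= \sum_i (x i)%:R ^+ 2.
Proof.
move=> adm jd free; pose U' : finType := {u : U & 'I_(x u)}; pose h (p : U') := tag p.
have := admissible_pattern adm (pattern_pull h jd)
  (hom_free_comp (h := h) (fun _ _ e => e) (fun _ _ e => e) free).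
have -> : #|{: U'}|%:R = \sum_i (x i)%:R :> R.
  rewrite -[#|_|]sum1_card natr_sum (sum_tag (fun u => 'I_(x u)) (fun=> 1)).
  by apply: eq_bigr => u _; rewrite card_ord mul1r.
have -> : \sum_p \sum_q weight rho (fun p q : U' => neq_rel (h p) (h q))
    (fun p q => d (h p) (h q)) p q
    = qform (weight rho (@neq_rel U) d) (fun i => (x i)%:R).
  transitivity (\sum_(p : U') \sum_k weight rho (@neq_rel U) d (tag p) k * (x k)%:R).
    apply: eq_bigr => p _.
    rewrite -[RHS](eq_bigr _ (fun u _ => congr1 (fun n => _ * n%:R) (card_ord (x u)))).
    by rewrite -(sum_tag _ (fun k => weight rho (@neq_rel U) d (tag p) k)).
  rewrite (sum_tag _ (fun i => \sum_k weight rho (@neq_rel U) d i k * (x k)%:R)).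
  apply: eq_bigr => i _; rewrite card_ord mulr_suml; apply: eq_bigr => k _; ring.
by rewrite qform_complete//; lra.
Qed.

Lemma adj_ge0 (R : realType) (U : Type) (d : rel U) i k : 0 <= adj R d i k.
Proof. exact: ler0n. Qed.

(* Natural vectors suffice: approximate [K x] by its integer part. *)
Lemma qform_nat_ge0 (R : realType) (U : finType) (A : U -> U -> R) (c : R) :
  0 <= c -> (forall i k, 0 <= A i k) ->
  (forall x : U -> nat, c * qform A (fun i => (x i)%:R) <= \sum_i (x i)%:R ^+ 2) ->
  forall x : U -> R, c * qform A x <= \sum_i x i ^+ 2.
Proof.
(* The entries of [A] are nonnegative, so passing to absolute values can only raise the form. *)
move=> c0 A0 H; suff pos (x : U -> R) : (forall i, 0 <= x i) ->
    c * qform A x <= \sum_i x i ^+ 2.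
  move=> x; have := pos (fun i => `|x i|) (fun i => normr_ge0 _).
  rewrite (eq_bigr (fun i => x i ^+ 2)) => [|i _]; last by rewrite real_normK ?num_real.
  apply: le_trans; rewrite ler_wpM2l//; apply: ler_sum => i _; apply: ler_sum => k _.
  by rewrite ler_wpM2l// -normrM ler_norm.
move=> x0; pose C := \sum_i \sum_k A i k * (x i + x k).
apply/ler_addgt0Pr => e e0.
have [K0 /(_ K0.+1 (leqnSn _))] := natr_bound (c * C / e).
set K : R := K0.+1%:R; have K_gt0 : 0 < K by rewrite ltr0n.
rewrite ler_pdivrMr// => hK.
(* Rounding down costs the form at most [K * C], negligible against [K ^ 2]. *)
pose z i := Num.truncn (K * x i).
have zP i : (z i)%:R <= K * x i /\ K * x i - 1 <= (z i)%:R.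
  have /andP[-> /ltW] := truncn_itv (mulr_ge0 (ltW K_gt0) (x0 i)).
  by rewrite -natr1 lerBlDr.
have up : \sum_i (z i)%:R ^+ 2 <= K ^+ 2 * \sum_i x i ^+ 2.
  rewrite mulr_sumr; apply: ler_sum => i _; rewrite -exprMn.
  apply: lerXn2r; rewrite ?nnegrE//; last by case: (zP i).
  by rewrite mulr_ge0// ltW.
have low : K ^+ 2 * qform A x - K * C <= qform A (fun i => (z i)%:R).
  rewrite /bform /C !mulr_sumr -sumrB; apply: ler_sum => i _.
  rewrite !mulr_sumr -sumrB; apply: ler_sum => k _.
  have [zi zi'] := zP i; have [zk zk'] := zP k.
  have -> : K ^+ 2 * (A i k * (x i * x k)) - K * (A i k * (x i + x k)) =
    A i k * (K * x i * (K * x k) - K * x i - K * x k) by ring.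
  rewrite ler_wpM2l//.
  apply: (@le_trans _ _ ((z i)%:R * (K * x k - 1))); last by rewrite ler_wpM2l.
  have : (K * x i - 1) * (K * x k) <= (z i)%:R * (K * x k).
    by rewrite ler_wpM2r// mulr_ge0// ltW.
  by lra.
have K2 : 0 < K ^+ 2 by rewrite exprn_gt0.
rewrite -(ler_pM2l K2).
have := le_trans (ler_wpM2l c0 low) (le_trans (H z) up).
have : K * (c * C) <= K * (K * e) by rewrite ler_pM2l// mulrC.
by nra.
Qed.

Lemma admissible_complete (R : realType) (V : finType) (F : mixed_graph V)
    (rho : R) (U : finType) (d : rel U) (x : U -> R) :
  1 <= rho -> admissible F rho ->
  pattern (@neq_rel U) d -> hom_free F (@neq_rel U) d ->
  (rho - 1) * qform (adj R d) x <= \sum_i x i ^+ 2.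
Proof.
move=> rho1 adm jd free; apply: qform_nat_ge0; [by rewrite subr_ge0|exact: adj_ge0|].
by move=> z; exact: admissible_complete_nat adm jd free.
Qed.

(** * Directed stars *)

Definition out_star (p : nat) : rel 'I_p.+1 :=
  fun a b => (a == ord0) && (b != ord0).

Definition in_star (p : nat) : rel 'I_p.+1 := fun a b => out_star b a.

Lemma out_star_pattern p : pattern (@neq_rel 'I_p.+1) (@out_star p).
Proof.
split=> [a b|a|a b|a b]; rewrite /neq_rel /out_star ?eqxx 1?eq_sym//.
- by case/andP=> /eqP->; rewrite eq_sym.
- by case/andP=> /eqP-> /negPf->.
Qed.

Lemma in_star_pattern p : pattern (@neq_rel 'I_p.+1) (@in_star p).
Proof.
have [js ji dj da] := out_star_pattern p.
by split=> // a b; [rewrite js; exact: dj|exact: da].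
Qed.

Lemma qform_star (R : realType) (p : nat) (d : rel 'I_p.+1) (c : R) :
  d =2 @out_star p \/ d =2 @in_star p ->
  qform (adj R d) (fun i => if i == ord0 then c else 1) = 2 * c * p%:R.
Proof.
move=> dE; have aE i k : adj R d i k = ((i == ord0) != (k == ord0))%:R.
  by rewrite /adj; case: dE => dE; rewrite !dE /in_star /out_star; do 2!case: (_ == ord0).
set x := fun i => _.
have x0 : x ord0 = c by [].
have xS (k : 'I_p) : x (lift ord0 k) = 1 by [].
have a00 : adj R d ord0 ord0 = 0 by rewrite aE eqxx.
have a0S (k : 'I_p) : adj R d ord0 (lift ord0 k) = 1 by rewrite aE.
have aS0 (k : 'I_p) : adj R d (lift ord0 k) ord0 = 1 by rewrite aE.
have aSS (i k : 'I_p) : adj R d (lift ord0 i) (lift ord0 k) = 0 by rewrite aE.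
have r0 : \sum_k adj R d ord0 k * (x ord0 * x k) = c * p%:R.
  rewrite big_ord_recl a00 mul0r add0r (eq_bigr (fun=> c)) => [|k _].
    by rewrite sumr_const card_ord mulr_natr.
  by rewrite a0S x0 xS mulr1 mul1r.
have rS (i : 'I_p) : \sum_k adj R d (lift ord0 i) k * (x (lift ord0 i) * x k) = c.
  rewrite big_ord_recl big1 => [|k _]; last by rewrite aSS mul0r.
  by rewrite aS0 xS x0 !mul1r addr0.
rewrite /bform big_ord_recl r0 (eq_bigr (fun=> c)) => [|i _]; last exact: rS.
by rewrite sumr_const card_ord -[c *+ p]mulr_natr; ring.
Qed.

(* Weight q at the centre and 1 at the q^2 leaves: q^3 outgrows q^2. *)
Lemma star_bound (R : realType) (V : finType) (F : mixed_graph V) (rho : R) :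
  1 < rho -> admissible F rho -> exists p : nat, forall d : rel 'I_p.+1,
  pattern (@neq_rel 'I_p.+1) d ->
  d =2 @out_star p \/ d =2 @in_star p -> exists phi, is_hom F (@neq_rel 'I_p.+1) d phi.
Proof.
move=> rho1 adm; have r0 : 0 < rho - 1 by rewrite subr_gt0.
(* The form bound would read [2 * q ^ 3 * (rho - 1) <= 2 * q ^ 2], which [q * (rho - 1) >= 2]
   excludes. *)
have [q0 /(_ q0.+2 (leqW (leqnSn _)))] := natr_bound (2 / (rho - 1)).
set q := q0.+2; rewrite ler_pdivrMr// => hq.
exists (q ^ 2)%N => d jd ds; apply: contrapT => /forallNP none.
have free : hom_free F (@neq_rel 'I_(q ^ 2).+1) d by move=> phi; apply/negP; exact: none.
have := admissible_complete (fun i => if i == ord0 then q%:R else 1) (ltW rho1) adm jd free.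
rewrite qform_star// big_ord_recl eqxx.
under eq_bigr => i _ do rewrite /= expr1n.
rewrite sumr_const card_ord natrX.
have q_gt0 : 0 < q%:R :> R by rewrite ltr0n.
have : 0 < q%:R ^+ 2 :> R by rewrite exprn_gt0.
have -> : (rho - 1) * (2 * q%:R * q%:R ^+ 2) = 2 * (q%:R * (rho - 1)) * q%:R ^+ 2 by ring.
by nra.
Qed.

(** A homomorphism to the out-star puts all tails at the centre, so tails are pairwise unjoined and
    none is a head; the in-star does the same for heads. Hence tails can go to [a], heads to [b],
    and the other vertices injectively to the at least [#|V|] vertices left. *)
Lemma stars_to_edge (V U : finType) (F : mixed_graph V) (p : nat) phi phi'
    (d : rel U) (a b : U) :
  is_hom F (@neq_rel 'I_p.+1) (@out_star p) phi ->
  is_hom F (@neq_rel 'I_p.+1) (@in_star p) phi' ->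
  d a b -> a != b -> (#|V| + 2 <= #|U|)%N ->
  exists chi, is_hom F (@neq_rel U) d chi.
Proof.
move=> /is_homP[hu hd] /is_homP[hu' hd'] dab ab cU.
pose tl x := [exists y, (x, y) \in dedges F].
pose hd_ y := [exists x, (x, y) \in dedges F].
have tl0 x : tl x -> phi x = ord0 by case/existsP=> y /hd/andP[/eqP].
have hd0 y : hd_ y -> phi' y = ord0 by case/existsP=> x /hd'/andP[/eqP].
have hdN y : hd_ y -> tl y = false.
  case/existsP=> x /hd/andP[_ phiy]; apply: contraNF phiy => ty.
  by rewrite (tl0 y ty).
have [i [inj iab]] : exists i : V -> U, injective i /\ forall x, i x \in (~: [set a; b])%SET.
  apply: injective_choice => _.
  by rewrite -(leq_add2r 2) (leq_trans cU)// -(cardsC [set a; b]%SET) addnC cards2 ab.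
have ia x : (i x == a) = false.
  by have := iab x; rewrite !inE negb_or => /andP[/negPf].
have ib x : (i x == b) = false.
  by have := iab x; rewrite !inE negb_or => /andP[_ /negPf].
exists (fun x => if tl x then a else if hd_ x then b else i x).
apply/is_homP; split=> x y xy; last first.
  have tx : tl x by apply/existsP; exists y.
  have hy : hd_ y by apply/existsP; exists x.
  by rewrite tx (hdN _ hy) hy.
have := hu _ _ xy; have := hu' _ _ xy; rewrite /neq_rel => n' n.
have xy' : x != y by apply: contraNneq n => ->.
case: (boolP (tl x)) => [tx|_]; case: (boolP (tl y)) => [ty|_].
- by rewrite (tl0 x tx) (tl0 y ty) eqxx in n.
- by case: ifP => _ //; rewrite eq_sym ia.
- by case: ifP => _; rewrite ?ia// eq_sym.
case: (boolP (hd_ x)) => [hx|_]; case: (boolP (hd_ y)) => [hy|_].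
- by rewrite (hd0 x hx) (hd0 y hy) eqxx in n'.
- by rewrite eq_sym ib.
- by rewrite ib.
- by rewrite (inj_eq inj).
Qed.

(** * Perturbation of semidefinite forms *)

Lemma bform_mx (R : realType) (n : nat) (M : 'M[R]_n) (x y : 'rV[R]_n) :
  (x *m M *m y^T) 0 0 = bform M (x 0) (y 0).
Proof.
rewrite !mxE /bform exchange_big /=; apply: eq_bigr => k _; rewrite !mxE mulr_suml.
by apply: eq_bigr => i _; ring.
Qed.

Lemma normr_qform_le (R : realType) (U : finType) (A : U -> U -> R) (x : U -> R) :
  `|qform A x| <= (\sum_i \sum_k `|A i k|) * \sum_i x i ^+ 2.
Proof.
rewrite mulr_suml; apply: le_trans (ler_norm_sum _ _ _) _; apply: ler_sum => i _.
rewrite mulr_suml; apply: le_trans (ler_norm_sum _ _ _) _; apply: ler_sum => k _.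
rewrite normrM ler_wpM2l//.
have sq a : x a ^+ 2 <= \sum_i x i ^+ 2.
  by rewrite (bigD1 a) //= lerDl sumr_ge0// => b _; exact: sqr_ge0.
have := sq i; have := sq k; rewrite -(real_normK (num_real (x i))).
rewrite -(real_normK (num_real (x k))) normrM => hk hi.
by have := sqr_ge0 (`|x i| - `|x k|); nra.
Qed.

(* A positive semidefinite invertible form Q dominates a multiple of the
   Euclidean norm: with y = Q^-1 x, expand 0 <= Q(x - y / K). *)
Lemma psd_invertible_coercive (R : realType) (n : nat) (Q : 'M[R]_n) :
  Q^T = Q -> (forall x, 0 <= qform Q x) -> \det Q != 0 ->
  exists2 K : R, 0 < K & forall x, \sum_i x i ^+ 2 <= K * qform Q x.
Proof.
move=> Qs Q0 detQ; have Qu : Q \in unitmx by rewrite unitmxE unitfE.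
pose N := invmx Q; have Ns : N^T = N by rewrite /N trmx_inv Qs.
pose K := 1 + \sum_i \sum_k `|N i k|.
have K0 : 0 < K by rewrite ltr_pwDl// sumr_ge0// => i _; exact: sumr_ge0.
exists K => // x; pose X : 'rV[R]_n := \row_i x i.
have XE : X 0 = x :> (_ -> _) by apply/funext => i; rewrite mxE.
(* As [N] inverts [Q], the form at [Y] is [Q(x) - 2 s |x|^2 + s^2 N(x)]; by the choice of [K] the
   last term is at most [s |x|^2]. *)
pose s := K^-1; pose Y := X - s *: (X *m N).
have := Q0 (Y 0); rewrite -bform_mx.
have NQ : X *m N *m Q = X by rewrite -mulmxA mulVmx// mulmx1.
have -> : Y *m Q *m Y^T = X *m Q *m X^T - (2 * s) *: (X *m X^T) + s ^+ 2 *: (X *m N *m X^T).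
  have -> : Y^T = X^T - s *: (N *m X^T).
    by rewrite /Y linearB linearZ /= trmx_mul Ns.
  rewrite /Y mulmxBl -scalemxAl NQ mulmxBl !mulmxBr -!scalemxAr -!scalemxAl.
  rewrite -[X *m Q *m (N *m X^T)]mulmxA (mulmxA Q) mulmxV// mul1mx mulmxA.
  by apply/matrixP => i j; rewrite !mxE; ring.
have entry (A B C : 'M[R]_1) a b :
    (A - a *: B + b *: C) 0 0 = A 0 0 - a * B 0 0 + b * C 0 0 by rewrite !mxE.
rewrite entry !bform_mx XE.
have -> : (X *m X^T) 0 0 = \sum_i x i ^+ 2.
  by rewrite mxE; apply: eq_bigr => i _; rewrite !mxE expr2.
set S := \sum_i _; set q := qform Q x => h.
have S0 : 0 <= S by apply: sumr_ge0 => i _; exact: sqr_ge0.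
have up : qform N x <= K * S.
  apply: le_trans (ler_norm _) _; apply: le_trans (normr_qform_le _ _) _.
  by rewrite ler_wpM2r// lerDr.
have sK : s * K = 1 by rewrite mulVf// lt0r_neq0.
have s0 : 0 < s by rewrite invr_gt0.
have : s ^+ 2 * qform N x <= s * S.
  apply: le_trans (ler_wpM2l (sqr_ge0 s) up) _.
  by rewrite expr2 -mulrA [s * (K * S)]mulrA sK mul1r.
move=> h2; have : s * S <= q by lra.
by rewrite -(ler_pM2l K0) mulrA [K * s]mulrC sK mul1r.
Qed.

(** When [1 - c A] is nonsingular, its form is coercive, which leaves room for a larger factor. A
    whole interval of [eta'] is given so that finitely many bounds can share one value. *)
Lemma qform_bound_open (R : realType) (n : nat) (A : 'M[R]_n) (c : R) :
  A^T = A -> (forall x, c * qform A x <= \sum_i x i ^+ 2) ->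
  \det (1%:M - c *: A) != 0 ->
  exists2 eta : R, 0 < eta & forall eta', 0 <= eta' <= eta ->
    forall x, (c + eta') * qform A x <= \sum_i x i ^+ 2.
Proof.
move=> As H det.
have QE x : qform (1%:M - c *: A) x = \sum_i x i ^+ 2 - c * qform A x.
  rewrite /bform mulr_sumr -sumrB; apply: eq_bigr => i _.
  rewrite mulr_sumr expr2 -(sum_delta (fun k => x i * x k)) -sumrB.
  by apply: eq_bigr => k _; rewrite !mxE eq_sym; ring.
have [||K K0 hK] := psd_invertible_coercive _ _ det.
- by rewrite linearB /= linearZ /= As trmx1.
- by move=> x; rewrite QE subr_ge0.
pose B := 1 + \sum_i \sum_k `|A i k|.
have B0 : 0 < B by rewrite ltr_pwDl// sumr_ge0// => i _; exact: sumr_ge0.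
exists (K * B)^-1; first by rewrite invr_gt0 mulr_gt0.
move=> e /andP[e0 eB] x; have := hK x; rewrite QE.
set S := \sum_i _; set q := qform A x => h.
have S0 : 0 <= S by apply: sumr_ge0 => i _; exact: sqr_ge0.
have up : q <= B * S.
  apply: le_trans (ler_norm _) _; apply: le_trans (normr_qform_le _ _) _.
  by rewrite ler_wpM2r// lerDr.
have e1 : K * (e * (B * S)) <= S.
  rewrite -[leRHS]mul1r !mulrA ler_wpM2r// -mulrA mulrCA.
  by rewrite -ler_pdivlMr ?mulr_gt0// div1r.
have e2 : K * (e * q) <= K * (e * (B * S)) by rewrite ler_pM2l// ler_wpM2l.
by rewrite -(ler_pM2l K0); lra.
Qed.

(** * Finitely many patterns and algebraicity *)

Lemma uniform_pos (R : realType) (Z : finType) (P : Z -> R -> Prop) :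
  (forall z, exists2 eta : R, 0 < eta & forall eta', 0 <= eta' <= eta -> P z eta') ->
  exists2 eta : R, 0 < eta & forall z, P z eta.
Proof.
move=> H; have [f f0 fP] := fin_all_exists2 H.
pose eta := \big[Order.min/1]_z f z.
have eta0 : 0 < eta by apply: lt_bigmin => // z _; exact: f0.
by exists eta => // z; apply: fP; rewrite ltW//= bigmin_le.
Qed.


(** [t] is a root of the rational polynomial [det (1 - (X - 1) B)], nonzero because its value at 1
    is [det 1 = 1]. *)
Lemma algebraic_det_root (R : realType) (k : nat) (d : rel 'I_k) (t : R) :
  \det (1%:M - (t - 1) *: \matrix_(i, j) adj R d i j) = 0 ->
  algebraicOver (ratr : rat -> R) t.
Proof.
move=> det0.
pose M : 'M[{poly rat}]_k :=
  1%:M - ('X - 1%:P) *: \matrix_(i, j) (d i j || d j i)%:R.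
exists (\det M).
  apply/negP => /eqP M0; have : (\det M).[1] = 0 by rewrite M0 horner0.
  rewrite -[_.[1]]/(horner_eval 1 (\det M)) -det_map_mx.
  rewrite (_ : map_mx _ _ = 1%:M) ?det1 => [/eqP|]; first by rewrite oner_eq0.
  apply/matrixP => i j; rewrite !mxE /= /horner_eval -!polyC_natr.
  by rewrite hornerD hornerN hornerM hornerXsubC subrr mul0r subr0 hornerC.
rewrite /root -[_.[t]]/(horner_eval t _) -!det_map_mx.
rewrite (_ : map_mx _ _ = 1%:M - (t - 1) *: \matrix_(i, j) adj R d i j) ?det0//.
apply/matrixP => i j; rewrite !mxE /= /horner_eval.
rewrite rmorphB rmorphM rmorphB /= map_polyX map_polyC /= rmorph1 !rmorph_nat.
by rewrite -!polyC_natr hornerD hornerN hornerM hornerXsubC !hornerC.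
Qed.

Theorem theorem1p9 (R : realType) (V : finType) (F : mixed_graph V)
    (theta_fin : (theta R F < +oo)%E) :
  exists2 t : R, theta R F = t%:E & algebraicOver (ratr : rat -> R) t.
Proof.
have [t [thetaE adm tmax]] := theta_max theta_fin; exists t => //.
have t1 : 1 <= t.
  apply: tmax; apply: complete_admissible => // k d _ _ x _.
  by rewrite subrr mul0r sumr_ge0// => i _; exact: sqr_ge0.
move: t1; rewrite le_eqVlt => /orP[/eqP<-|t1].
  by apply: algebraic1.
have [p hp] := star_bound t1 adm.
have [phi hphi] := hp _ (@out_star_pattern p) (or_introl (fun _ _ => erefl)).
have [phi' hphi'] := hp _ (@in_star_pattern p) (or_intror (fun _ _ => erefl)).
pose m := (#|V| + 2)%N.
(* If [t] is not algebraic, no determinant vanishes at [t], so the bound of every small pattern has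
   slack. *)
apply: contrapT => alg.
pose ok k (d : rel 'I_k) := pattern (@neq_rel 'I_k) d /\ hom_free F (@neq_rel 'I_k) d.
(* The relations on fewer than [m] vertices form a finite type, so one slack [eta] serves them
   all. *)
pose Z : finType := {k : 'I_m & {ffun 'I_k * 'I_k -> bool}}.
have [eta eta0 etaP] : exists2 eta : R, 0 < eta & forall z : Z,
    let d : rel 'I_(tag z) := fun i j => tagged z (i, j) in
    ok _ d -> forall x, (t - 1 + eta) * qform (adj R d) x <= \sum_i x i ^+ 2.
  apply: uniform_pos => z; pose d : rel 'I_(tag z) := fun i j => tagged z (i, j).
  case: (pselect (ok _ d)) => [[jd free]|nok]; last first.
    by exists 1 => // eta' _ d' /nok.
  pose A : 'M[R]_(tag z) := \matrix_(i, j) adj R d i j.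
  have AE : (A : 'I__ -> 'I__ -> R) = adj R d.
    by do 2!apply/funext => ?; rewrite mxE.
  have [|x||eta eta0 hEta] := @qform_bound_open R (tag z) A (t - 1).
  - by apply/matrixP => i j; rewrite !mxE /adj orbC.
  - by rewrite AE; exact: admissible_complete (ltW t1) adm jd free.
  - by apply/eqP => /algebraic_det_root.
  by exists eta => // eta' /hEta h d' _ x; have := h x; rewrite AE.
suff /tmax : admissible F (t + eta) by rewrite gerDl leNgt eta0.
apply: complete_admissible => [|k d jd free x _].
  by rewrite (le_trans (ltW t1))// lerDl ltW.
rewrite addrAC; have [km|mk] := ltnP k m.
  pose z : Z := Tagged (fun k : 'I_m => {ffun 'I_k * 'I_k -> bool})
    (i := Ordinal km) [ffun q => d q.1 q.2].
  have dE : (fun i j => tagged z (i, j)) = d.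
    by do 2!apply/funext => ?; rewrite /= ffunE.
  by have /= := etaP z; rewrite dE; apply.
(* With at least [m] vertices, a directed edge would give a homomorphism from F; so there is none,
   and the form is zero. *)
rewrite [X in _ * X]big1 ?mulr0 => [|i _]; first exact: (sumr_ge0 _ (fun i _ => sqr_ge0 (x i))).
apply: big1 => j _; suff -> : adj R d i j = 0 by rewrite mul0r.
suff dF a b : d a b = false by rewrite /adj !dF.
apply/negP => dab; have [_ _ dj _] := jd.
have cU : (#|V| + 2 <= #|'I_k|)%N by rewrite card_ord.
have [chi hchi] := stars_to_edge hphi hphi' dab (dj _ _ dab) cU.
by have := free chi; rewrite hchi.
Qed.
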